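(* Let $q$ be a prime power and let $i,j,n,m$ be positive integers with $1\le ij\le\min\{n,m\}$. Then $$w_j(i,n,m;q)=\sum_{s=1}^{ij}\begin{bmatrix}n\\ s\end{bmatrix}_q\sum_{t=1}^{s}w_j(i,t,m;q)\begin{bmatrix}s\\ t\end{bmatrix}_q q^{\binom{s-t}{2}}(-1)^{s-t}.$$
   Context: The rank $\mathrm{rk}(v)$ of $v\in\mathbb{F}_{q^m}^n$ is the dimension over $\mathbb{F}_q$ of the $\mathbb{F}_q$-span of its entries. For $i\ge1$ let $T_i(n,m;q)=\{v\in\mathbb{F}_{q^m}^n:\mathrm{rk}(v)\le i\}$. The rank-metric lattice $\mathscr{L}_i(n,m;q)$ is the set of all $\mathbb{F}_{q^m}$-subspaces of $\mathbb{F}_{q^m}^n$ of the form $\langle v_1,\ldots,v_\ell\rangle_{\mathbb{F}_{q^m}}$ with $\ell\ge1$ and $v_1,\ldots,v_\ell\in T_i(n,m;q)$ (including $\{0\}$), ordered by inclusion; for $i\ge n$ it is the lattice of all subspaces. It is a finite geometric lattice whose rank function is $\mathbb{F}_{q^m}$-dimension. Its $j$-th Whitney number of the first kind is $w_j(i,n,m;q)=\sum_{X}\mu(X)$, where the sum is over $X\in\mathscr{L}_i(n,m;q)$ with $\dim_{\mathbb{F}_{q^m}}X=j$ and $\mu(X)=\mu(\{0\},X)$ is the Möbius function of the lattice (so $w_j(i,n,m;q)=0$ if $j>n$). $\begin{bmatrix}a\\ b\end{bmatrix}_{q}$ is the Gaussian binomial coefficient (number of $b$-dimensional subspaces of an $a$-dimensional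 space over $\mathbb{F}_q$). *)

(* Defs.v *)
From HB Require Import structures.
From mathcomp Require Export all_boot all_order all_algebra all_field.

Set Implicit Arguments.
Unset Strict Implicit.
Unset Printing Implicit Defensive.

Import Order.TTheory GRing.Theory.
Local Open Scope ring_scope.

Section Mobius.
Variables (d : Order.disp_t) (P : finPOrderType d).
Implicit Types x y z : P.

(* [k] is fuel: each unfolding strictly decreases [y], so [#|P|] steps are    *)
(* enough, and the defining recursion is [mobiusE] below.                     *)
Fixpoint mobius_rec (k : nat) x y : int :=
  if k is k'.+1 then
    if x == y then 1
    else - \sum_(z : P | (x <= z)%O && (z < y)%O) mobius_rec k' x z
  else 0.

Definition mobius x y : int := mobius_rec #|P| x y.

Lemma mobius_rec_stable k l x y :
    (#|[set z : P | (z <= y)%O]| <= k)%N -> (#|[set z : P | (z <= y)%O]| <= l)%N ->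
  mobius_rec k x y = mobius_rec l x y.
Proof.
have gt0 y' : (0 < #|[set z : P | (z <= y')%O]|)%N.
  by apply/card_gt0P; exists y'; rewrite inE.
elim: k l y => [|k IHk] [|l] y; rewrite ?leqn0 ?(gtn_eqF (gt0 y)) //= => le_k le_l.
case: eqP => // _; congr (- _); apply: eq_bigr => z /andP[_ lt_zy].
have lt_card : (#|[set t : P | (t <= z)%O]| < #|[set t : P | (t <= y)%O]|)%N.
  apply/proper_card/properP; split.
    by apply/subsetP=> t; rewrite !inE => /le_trans; apply; apply: ltW.
  by exists y; rewrite inE // lt_geF.
by apply: IHk; rewrite -ltnS; apply: leq_trans lt_card _.
Qed.

Lemma mobiusE x y :
  mobius x y =
    if x == y then 1 else - \sum_(z : P | (x <= z)%O && (z < y)%O) mobius x z.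
Proof.
have leP z : (#|[set t : P | (t <= z)%O]| <= #|P|)%N by exact: max_card.
rewrite {1}/mobius (@mobius_rec_stable _ #|P|.+1) ?(leqW (leP y)) //=.
Qed.

Lemma mobius_sum x y : (x <= y)%O ->
  \sum_(z : P | (x <= z)%O && (z <= y)%O) mobius x z = (x == y)%:R.
Proof.
move=> le_xy; rewrite (bigD1 y) /= ?le_xy ?lexx // mobiusE.
under eq_bigl => z do rewrite -andbA (andbC (z <= y)%O) -lt_neqAle.
case: eqP => [->|_]; last by rewrite addNr.
by rewrite big_pred0 ?addr0 // => z; apply/negP=> /andP[/le_lt_trans h /h]; rewrite ltxx.
Qed.

End Mobius.

Section SubspacePoset.
Variables (K : fieldType) (vT : vectType K).

Fact subsetv_display : Order.disp_t. Proof. exact: Order.Disp tt tt. Qed.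

Fact subsetv_anti : antisymmetric (@subsetv K vT).
Proof. by move=> U V UV; apply/eqP; rewrite eqEsubv. Qed.

Fact subsetv_transitive : transitive (@subsetv K vT).
Proof. by move=> V U W; apply: subv_trans. Qed.

HB.instance Definition _ := Order.Le_isPOrder.Build subsetv_display
  {vspace vT} (@subvv K vT) subsetv_anti subsetv_transitive.
End SubspacePoset.

Section FinSubspaces.
Variables (K : finFieldType) (vT : vectType K).
Import VectorInternalTheory.
HB.instance Definition _ := [Countable of {vspace vT} by <:].
HB.instance Definition _ := [Finite of {vspace vT} by <:].
End FinSubspaces.

Definition qbinom (F : finFieldType) (a b : nat) : nat :=
  #|[set U : {vspace 'rV[F]_a} | \dim U == b]|.

Section RankMetricLattice.
Variables (F : finFieldType) (L : fieldExtType F).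

(* [L] with its canonical finite field structure.                             *)
Local Notation K := (finvect_type L).

(* The dimension is over [F], unlike the one in [whitney1] which is over [K]. *)
Definition rank_weight n (v : 'rV[K]_n) : nat :=
  \dim (span [seq (v 0 k : L) | k : 'I_n] : {vspace L}).

Definition rank_ball i n : {set 'rV[K]_n} := [set v | (rank_weight v <= i)%N].

(* Finite families of vectors are given by their underlying sets; the empty   *)
(* set also yields the zero space, see [rml_spacesP].                         *)
Definition rml_spaces i n : {set {vspace 'rV[K]_n}} :=
  [set X | [exists A : {set 'rV[K]_n},
              (A \subset rank_ball i n) && (X == <<enum A>>%VS)]].

Lemma zero_rank_ball i n : 0 \in rank_ball i n.
Proof.
rewrite inE /rank_weight [X in \dim X](_ : _ = 0%VS) ?dimv0 //.
apply/eqP; rewrite -subv0; apply/span_subvP => x /mapP[k _ ->].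
by rewrite mxE memv0.
Qed.

Lemma rml_spacesP i n (X : {vspace 'rV[K]_n}) :
  reflect (exists2 s : seq 'rV[K]_n,
             (0 < size s)%N && all (mem (rank_ball i n)) s & X = <<s>>%VS)
          (X \in rml_spaces i n).
Proof.
rewrite inE; apply: (iffP existsP) => [[A /andP[/subsetP sAT /eqP ->]]|].
  exists (0 :: enum A) => [|/=].
    by rewrite /= zero_rank_ball; apply/allP=> v; rewrite mem_enum => /sAT.
  by rewrite span_cons add0v.
case=> s /andP[_ /allP sT] ->; exists [set v in s]; apply/andP; split.
  by apply/subsetP=> v; rewrite inE => /sT.
by apply/eqP/eq_span => v; rewrite mem_enum inE.
Qed.

Definition rmlattice i n : predArgType := {X | X \in rml_spaces i n}.

HB.instance Definition _ i n := Finite.on (rmlattice i n).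
HB.instance Definition _ i n := SubChoice.on (rmlattice i n).
HB.instance Definition _ i n :=
  [SubChoice_isSubPOrder of rmlattice i n by <: with subsetv_display].

Fact zero_rml_spaces i n : 0%VS \in rml_spaces i n.
Proof.
apply/rml_spacesP; exists [:: 0]; first by rewrite /= zero_rank_ball.
by rewrite span_seq1.
Qed.

Definition rml0 i n : rmlattice i n := exist _ 0%VS (zero_rml_spaces i n).

Definition whitney1 i n j : int :=
  \sum_(X : rmlattice i n | \dim (val X) == j) mobius (rml0 i n) X.

End RankMetricLattice.

(* Main.v *)
(** Every X in the lattice has a support, the least F-subspace U of F^n whose
    extension of scalars contains X, and the lattice elements supported in U
    form a lower interval isomorphic to the lattice of length dim U.  Moebius
    inversion over the subspaces of F^n thus expresses the sum of mu(X) over the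
    X of dimension j and support exactly U through the numbers w_j(i, t, m) with
    t <= dim U.  Since X is spanned by j vectors of rank at most i, only supports
    of dimension at most ij occur. *)

Require Import Defs.
Import GRing.Theory.
Local Open Scope ring_scope.

Set Implicit Arguments.
Unset Strict Implicit.
Unset Printing Implicit Defensive.
Import Order.TTheory.

(** * The Möbius function of the subspace lattice over F_q: [gauss_mobius q d] is its value on an
    interval of length [d] *)

Definition gauss_mobius (q d : nat) : int :=
  (-1) ^+ d * (q ^ 'C(d, 2))%:Z.

Lemma gauss_mobiusS q d :
  gauss_mobius q d.+1 = - ((q ^ d)%:Z * gauss_mobius q d).
Proof.
rewrite /gauss_mobius binS bin1 expnD PoszM exprS.
by rewrite mulN1r mulNr mulrA mulrC.
Qed.

Section SubspaceMobius.
Variables (F : finFieldType) (n : nat).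
Local Notation V := 'rV[F]_n.
Local Notation q := #|F|.
Implicit Types (U W X H : {vspace V}) (u v x : V).

(** [H] is [W] plus a complement of [W + <[u]>] in [U]. As [W] has one dimension less than [W +
    <[u]>], this sum is too small to be [U], which it would be if it contained [u]. *)
Lemma hyperplane_avoiding U W u : (W <= U)%VS -> u \in U -> u \notin W ->
  exists H, [/\ (W <= H)%VS, (H + <[u]> = U)%VS & u \notin H].
Proof.
move=> sWU Uu Wu; pose W' := (W + <[u]>)%VS.
have sW'U : (W' <= U)%VS by rewrite subv_add sWU -memvE.
have u_neq0 : u != 0 by apply: contra Wu => /eqP->; rewrite mem0v.
pose H := (W + (U :\: W'))%VS.
have HU : (H + <[u]> = U)%VS.
  rewrite /H -addvA [(_ + <[u]>)%VS]addvC addvA -/W' addvC addv_diff.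
  exact/addv_idPl.
exists H; split; rewrite ?addvSl //; apply/negP=> Hu.
have eqHU : H = U by rewrite -HU; apply/esym/addv_idPl; rewrite -memvE.
have := dimv_cap_compl U W'; rewrite (capv_idPr sW'U).
have -> : \dim W' = (\dim W).+1.
  rewrite dimv_disjoint_sum ?dim_vline ?u_neq0 ?addn1 //.
  apply/eqP; rewrite -subv0; apply/subvP=> x /memv_capP[Wx /vlineP[c xE]].
  rewrite memv0 xE; have [->|c0] := eqVneq c 0; first by rewrite scale0r.
  by case/negP: Wu; rewrite -(scalerK c0 u) rpredZ // -xE.
move/eqP; rewrite -[X in _ == \dim X]eqHU eqn_leq => /andP[+ _]; apply/negP.
by rewrite -ltnNge addSn ltnS; exact: (dimv_add_leqif _ _).1.
Qed.

Section Hyperplane.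
Variables (U H : {vspace V}) (u : V).
Hypotheses (HU : (H + <[u]> = U)%VS) (Hu : u \notin H).

Let u_neq0 : u != 0. Proof. by apply: contra Hu => /eqP->; rewrite mem0v. Qed.
Let sHU : (H <= U)%VS. Proof. by rewrite -HU addvSl. Qed.

(** Only the zero multiple of [u + x] lies in [H], so adjoining this line to [X] adds one dimension
    but nothing inside [H]. *)
Lemma line_translate X x : (X <= H)%VS -> x \in H ->
  ((X + <[u + x]>) :&: H = X)%VS /\ \dim (X + <[u + x]>)%VS = (\dim X).+1.
Proof.
move=> sXH Hx.
have Hux : u + x \notin H by rewrite rpredDr.
have ux0 : u + x != 0 by apply: contra Hux => /eqP->; rewrite mem0v.
have scal c : c *: (u + x) \in H -> c = 0.
  move=> cH; apply/eqP; apply: contraR Hux => c0.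
  by rewrite -(scalerK c0 (u + x)) rpredZ.
split.
  apply: subv_anti; apply/andP; split; last by rewrite subv_cap addvSl sXH.
  apply/subvP=> y /memv_capP[/memv_addP[a Xa [b /vlineP[c ->] ->]]] yH.
  rewrite (scal c) ?scale0r ?addr0 //.
  by rewrite -(rpredDl _ (subvP sXH _ Xa)).
rewrite dimv_disjoint_sum ?dim_vline ?ux0 ?addn1 //.
apply/eqP; rewrite -subv0; apply/subvP=> y /memv_capP[Xy /vlineP[c yE]].
by rewrite memv0 yE (scal c) ?scale0r // -yE (subvP sXH).
Qed.

(* The affine hyperplane [u + H] is cut by each [Y] not in [H] in a coset of
   [Y :&: H], so counting its [q ^ \dim H] points counts the [Y] over [X]. *)
Lemma card_over_hyperplane X : (X <= H)%VS ->
  #|[set Y : {vspace V} | [&& (Y <= U)%VS, ~~ (Y <= H)%VS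
                            & (Y :&: H == X)%VS]]| = (q ^ (\dim H - \dim X))%N.
Proof.
move=> sXH; set S := finset _.
have q_gt1 : (1 < q)%N by apply: card_finNzRing_gt1.
apply/eqP; rewrite -(eqn_pmul2r (_ : 0 < q ^ \dim X)%N) ?expn_gt0
  ?(ltnW q_gt1) //.
rewrite -expnD subnK ?dimvS // -!(@card_vspace F V); apply/eqP.
rewrite -[RHS]sum1_card.
have imS x : x \in H -> (X + <[u + x]>)%VS \in S.
  move=> Hx; have [cE _] := line_translate sXH Hx.
  rewrite inE cE eqxx andbT; apply/andP; split.
    rewrite subv_add (subv_trans sXH sHU) -memvE rpredD ?(subvP sHU x) //.
    by rewrite memvE -HU addvSr.
  apply/negP=> sH; have /subvP/(_ _ (memv_line (u + x))) : (<[u + x]> <= H)%VS.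
    by apply: subv_trans sH; apply: addvSr.
  by rewrite rpredDr // (negPf Hu).
rewrite (partition_big (fun x => X + <[u + x]>)%VS (mem S)) /=; last exact: imS.
rewrite -sum_nat_const; apply: eq_bigr => Y.
rewrite inE => /and3P[YU YH /eqP YX].
have [y Yy Hy] : exists2 y, y \in Y & y \notin H by apply/subvPn.
have /memv_addP[h Hh [b /vlineP[c bE] yE]] : y \in (H + <[u]>)%VS.
  by rewrite HU (subvP YU).
have c0 : c != 0.
  by apply: contra Hy => /eqP c0; rewrite yE bE c0 scale0r addr0.
(* Scaling [y] to have [u]-coordinate 1 gives the point [u + x0] of [Y]; the fibre over [Y] will be
   the translate [x0 + X]. *)
pose x0 := c^-1 *: h.
have Hx0 : x0 \in H by rewrite rpredZ.
have Yx0 : u + x0 \in Y.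
  suff -> : u + x0 = c^-1 *: y by rewrite rpredZ.
  by rewrite yE bE scalerDr scalerK // addrC.
rewrite sum1_card -(card_imset (mem X) (addrI x0)); apply: eq_card => x.
have eqY : (x \in H) && (X + <[u + x]> == Y)%VS
           = (x \in H) && (u + x \in Y).
  apply: andb_id2l => Hx; apply/eqP/idP => [<-|Yx].
    by rewrite (subvP (addvSr _ _)) ?memv_line.
  have [_ dX] := line_translate sXH Hx.
  apply/eqP; rewrite eqEdim dX subv_add -memvE Yx -YX capvSl /=.
  (* [Y :\: H] meets [H] trivially inside [U], where [H] has codimension at most 1, so it has
     dimension at most 1. *)
  rewrite -[(\dim _).+1]addn1 -[X in (X <= _)%N](dimv_cap_compl Y H) leq_add2l.
  rewrite -(leq_add2l (\dim H)) -dimv_disjoint_sum; last first.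
    by rewrite capvC capv_diff.
  rewrite addvC addv_diff.
  apply: leq_trans (_ : \dim U <= _)%N; first by rewrite dimvS // subv_add YU.
  rewrite -HU (leq_trans (dimv_add_leqif _ _).1) //.
  by rewrite dim_vline leq_add2l leq_b1.
transitivity ((x \in H) && (u + x \in Y)); last by rewrite -eqY.
apply/imsetP/andP => [[z]|[Hx Yx]].
  rewrite -YX => /memv_capP[Yz Hz] ->; split; first by rewrite rpredD.
  by rewrite addrA rpredD.
exists (x - x0); last by rewrite addrC subrK.
rewrite -YX; apply/memv_capP; split; last by rewrite rpredB.
by have := rpredB Yx Yx0; rewrite opprD addrACA subrr add0r.
Qed.
End Hyperplane.

(** This relation characterises mu(X, U). If W is proper in U, take a hyperplane H of U containing
    W. Each X in [W, H] is the trace on H of [q ^ (\dim H - \dim X)] subspaces of U outside H, all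
    of dimension [(\dim X).+1]; by [gauss_mobiusS] their terms cancel that of X. *)
Lemma sum_gauss_mobius W U : (W <= U)%VS ->
  \sum_(X : {vspace V} | (W <= X)%VS && (X <= U)%VS)
     gauss_mobius q (\dim U - \dim X) = (W == U)%:R.
Proof.
move=> sWU; have [->|neWU] := eqVneq W U.
  rewrite (big_pred1 U) => [|X]; last by rewrite -eqEsubv eq_sym.
  by rewrite subnn /gauss_mobius mulr1.
have /subvPn[u Uu Wu] : ~~ (U <= W)%VS.
  by apply: contra neWU => sUW; rewrite eqEsubv sWU.
have [H [sWH HU Hu]] := hyperplane_avoiding sWU Uu Wu.
have sHU : (H <= U)%VS by rewrite -HU addvSl.
have dU : \dim U = (\dim H).+1.
  by have [] := line_translate Hu (subvv H) (mem0v H); rewrite addr0 HU.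
rewrite (bigID (fun X => X <= H)%VS) /=.
rewrite [X in _ + X](partition_big (fun X => X :&: H)%VS
   (fun X => (W <= X)%VS && (X <= H)%VS)) /=; last first.
  by move=> X /andP[/andP[WX _] _]; rewrite subv_cap WX sWH capvSr.
rewrite (eq_bigl (fun X => (W <= X)%VS && (X <= H)%VS)) => [|X]; last first.
  by apply/andP/andP => [[/andP[]]|[-> XH]] //; rewrite XH (subv_trans XH).
rewrite -big_split big1 // => X /andP[WX XH] /=.
rewrite (eq_bigr (fun=> gauss_mobius q (\dim H - \dim X))); last first.
  move=> Y /andP[/andP[/andP[_ YU] YH] /eqP YX]; congr gauss_mobius.
  suff -> : \dim Y = (\dim X).+1 by rewrite dU subSS.
  have /subvPn[y Yy Hy] := YH.
  apply/eqP; rewrite eqn_leq -YX; apply/andP; split.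
    rewrite -(leq_add2l (\dim H)) addnS -addSn -dU addnC -dimv_sum_cap leq_add2r.
    by rewrite dimvS // subv_add YU.
  rewrite -(dimv_cap_compl Y H) -[(\dim _).+1]addn1 leq_add2l lt0n dimv_eq0.
  by rewrite diffv_eq0.
rewrite sumr_const (_ : #|_| = q ^ (\dim H - \dim X))%N; last first.
  rewrite -(card_over_hyperplane HU Hu XH) cardsE; apply: eq_card => Y.
  rewrite -!topredE /= -!andbA; apply/and4P/and3P => [[_ ? ? ?]|[? ? /eqP YX]] //.
  by split=> //; last exact/eqP; rewrite (subv_trans WX) // -YX capvSl.
rewrite dU subSn ?dimvS // gauss_mobiusS -mulr_natl -natz.
by rewrite addNr.
Qed.
End SubspaceMobius.

(** * Möbius functions of lower intervals, and free generating families *)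

Lemma mobius_embed d d' (P : finPOrderType d) (Q : finPOrderType d')
    (f : P -> Q) (x y : P) :
  {mono f : x y / (x <= y)%O} ->
  (forall x z, (z <= f x)%O -> exists y, z = f y) ->
  mobius (f x) (f y) = mobius x y.
Proof.
move=> f_mono f_down; have f_inj := inc_inj f_mono.
have [k] := ubnP #|[set z | (z <= y)%O]|; elim: k y => // k IHk y /ltnSE le_yk.
rewrite !mobiusE (inj_eq f_inj); case: eqP => // _; congr (- _).
have f_lt := leW_mono f_mono.
(* The image of [f] is closed downwards, so the part of the interval summed over by [mobiusE] is
   exactly the image of its counterpart in [P]. *)
transitivity (\sum_(z in [set f w | w in [set w | (x <= w)%O && (w < y)%O]])
    mobius (f x) z).
  apply: eq_bigl => z; apply/andP/imsetP => [[xz zy]|[w + ->]].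
    have [w zE] := f_down _ _ (ltW zy); exists w => //.
    by rewrite inE -f_mono -f_lt -zE xz.
  by rewrite inE f_mono f_lt => /andP.
rewrite big_imset /=; last by move=> ? ? _ _; apply: f_inj.
apply: eq_big => [w|w]; rewrite inE // => /andP[_ wy]; apply: IHk.
apply: leq_trans le_yk; apply/proper_card/properP; split.
  by apply/subsetP=> t; rewrite !inE => /le_trans; apply; apply: ltW.
by exists y; rewrite inE // lt_geF.
Qed.

(** Lets a lattice element X be generated by exactly [\dim X] vectors of rank at most i. *)
Lemma free_subseq (E : fieldType) (vT : vectType E) (s : seq vT) :
  exists s', [/\ {subset s' <= s}, free s' & <<s'>>%VS = <<s>>%VS].
Proof.
elim: s => [|v s [s' [s's fs' eq_s]]]; first by exists [::]; rewrite nil_free.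
have [sv|sv] := boolP (v \in <<s>>%VS).
  exists s'; split=> // [u /s's us|]; first by rewrite inE us orbT.
  by rewrite span_cons eq_s; apply/esym/addv_idPr; rewrite -memvE.
exists (v :: s'); split; last by rewrite !span_cons eq_s.
  by move=> u; rewrite !inE => /predU1P[->|/s's ->]; rewrite ?eqxx ?orbT.
by rewrite free_cons eq_s sv.
Qed.

(** * Coordinates on a subspace through a basis matrix, and counting subspaces *)

Section MulHom.
Variable E : fieldType.

Definition mul_hom a b (A : 'M[E]_(a, b)) : 'Hom('rV[E]_a, 'rV[E]_b) :=
  linfun (mulmxr A).

Lemma mul_homE a b (A : 'M[E]_(a, b)) v : mul_hom A v = v *m A.
Proof. by rewrite lfunE. Qed.

Definition basis_mx n (U : {vspace 'rV[E]_n}) : 'M[E]_(\dim U, n) :=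
  \matrix_(k < \dim U) (vbasis U)`_k.

Lemma mul_basis_mx n (U : {vspace 'rV[E]_n}) (w : 'rV_(\dim U)) :
  w *m basis_mx U = \sum_k w 0 k *: (vbasis U)`_k.
Proof. by rewrite mulmx_sum_row; apply: eq_bigr => k _; rewrite rowK. Qed.

Lemma row_free_basis_mx n (U : {vspace 'rV[E]_n}) : row_free (basis_mx U).
Proof.
apply: inj_row_free => w; rewrite mul_basis_mx => w0; apply/rowP=> k.
by have /freeP-> := basis_free (vbasisP U); rewrite ?mxE.
Qed.

Lemma mul_basis_mxP n (U : {vspace 'rV[E]_n}) v :
  reflect (exists w, v = w *m basis_mx U) (v \in U).
Proof.
apply: (iffP idP) => [Uv|[w ->]]; last first.
  rewrite mul_basis_mx rpred_sum // => k _.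
  by rewrite rpredZ ?vbasis_mem ?memt_nth.
exists (\row_k coord (vbasis U) k v); rewrite mul_basis_mx {1}(coord_vbasis Uv).
by apply: eq_bigr => k _; rewrite mxE.
Qed.

Lemma lker_mul_hom a b (A : 'M[E]_(a, b)) :
  row_free A -> lker (mul_hom A) == 0%VS.
Proof.
by move=> Af; apply/lker0P => u v; rewrite !mul_homE; apply: row_free_inj.
Qed.

End MulHom.

(** Multiplication by [basis_mx U] maps the row space of length [\dim U] isomorphically onto [U],
    hence carries subspaces to subspaces bijectively and keeps dimensions. *)
Lemma card_subspaces (F : finFieldType) n (U : {vspace 'rV[F]_n}) t :
  #|[set X : {vspace 'rV[F]_n} | (X <= U)%VS & \dim X == t]|
    = qbinom F (\dim U) t.
Proof.
have f_inj := lker_mul_hom (row_free_basis_mx U); set f := mul_hom _ in f_inj.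
have imf : limg f = U.
  apply/vspaceP=> v; apply/memv_imgP/mul_basis_mxP => [[w _ ->]|[w ->]].
    by exists w; rewrite mul_homE.
  by exists w; rewrite ?memvf ?mul_homE.
have dimf (Y : {vspace _}) : \dim (f @: Y) = \dim Y.
  by apply: limg_dim_eq; rewrite (eqP f_inj) capv0.
rewrite /qbinom -(card_imset _ (_ : injective (fun Y => f @: Y)%VS)); last first.
  by move=> X Y /eqP; rewrite eq_limg_ker0 // => /eqP.
apply: eq_card => X; rewrite inE; apply/andP/imsetP => [[XU dX]|[Y + ->]].
  exists (f @^-1: X)%VS; last by rewrite lpreimK ?imf.
  by rewrite inE -dimf lpreimK ?imf.
by rewrite inE dimf => ->; rewrite -[X in (_ <= X)%VS]imf limgS ?subvf.
Qed.

(** * Extension of scalars, rank and support *)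

Section Support.
Variables (F : finFieldType) (L : fieldExtType F).
Local Notation K := (finvect_type L).
Local Notation cf := (coord (vbasis {:L})).

Definition ext_hom a b (A : 'M[F]_(a, b)) : 'Hom('rV[K]_a, 'rV[K]_b) :=
  mul_hom (map_mx (in_alg K) A).

Lemma ext_homM a b c (A : 'M[F]_(a, b)) (B : 'M[F]_(b, c)) v :
  ext_hom B (ext_hom A v) = ext_hom (A *m B) v.
Proof. by rewrite !mul_homE map_mxM mulmxA. Qed.

Lemma ext_hom_entry a b (A : 'M[F]_(a, b)) (v : 'rV[K]_a) k :
  (ext_hom A v) 0 k = \sum_l A l k *: (v 0 l : L).
Proof.
by rewrite mul_homE mxE; apply: eq_bigr => l _; rewrite mxE mulr_algr.
Qed.

(** The entries of the image are [F]-combinations of the entries of [v]. *)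
Lemma rank_weight_ext a b (A : 'M[F]_(a, b)) v :
  (rank_weight (ext_hom A v) <= rank_weight v)%N.
Proof.
apply/dimvS/span_subvP => _ /mapP[k _ ->]; rewrite ext_hom_entry.
by apply: rpred_sum => l _; rewrite rpredZ // memv_span // map_f // mem_enum.
Qed.

Lemma rml_spaces_ext i a b (A : 'M[F]_(a, b)) (X : {vspace 'rV[K]_a}) :
  X \in rml_spaces L i a -> (ext_hom A @: X)%VS \in rml_spaces L i b.
Proof.
case/rml_spacesP=> s /andP[s0 /allP sT] ->; rewrite limg_span.
apply/rml_spacesP; exists (map (ext_hom A) s) => //; rewrite size_map s0 /=.
apply/allP=> _ /mapP[v /sT + ->]; rewrite !inE.
exact: leq_trans (rank_weight_ext A v).
Qed.

Definition coeff_row n (v : 'rV[K]_n) k : 'rV[F]_n := \row_l cf k (v 0 l : L).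

(** The row space of the matrix of [v] over [F], whose columns are the coordinates of the entries
    along a basis of [L]. *)
Definition vsupp n (v : 'rV[K]_n) : {vspace 'rV[F]_n} :=
  <<[seq coeff_row v k | k : 'I_(\dim {:L})]>>%VS.

Definition supp n (X : {vspace 'rV[K]_n}) : {vspace 'rV[F]_n} :=
  (\sum_(v in X) vsupp v)%VS.

Lemma coeff_row_ext a b (A : 'M[F]_(a, b)) v k :
  coeff_row (ext_hom A v) k = coeff_row v k *m A.
Proof.
apply/rowP=> l; rewrite !mxE ext_hom_entry linear_sum.
by apply: eq_bigr => r _; rewrite linearZ mxE mulrC.
Qed.

Lemma coeff_rowE n (v : 'rV[K]_n) :
  v = \sum_(k < \dim {:L})
        ((vbasis {:L})`_k : K) *: map_mx (in_alg K) (coeff_row v k).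
Proof.
apply/rowP=> l; rewrite summxE {1}(coord_vbasis (memvf (v 0 l : L))).
by apply: eq_bigr => k _; rewrite !mxE mulr_algr.
Qed.

(** The right side is membership in the extension of scalars of [U]. Coefficient rows commute with
    matrices over [F]; conversely, coefficient rows in [U] are lifted through [basis_mx U] and
    recombined along the basis of [L]. *)
Lemma vsuppP n (U : {vspace 'rV[F]_n}) v :
  (vsupp v <= U)%VS = (v \in limg (ext_hom (basis_mx U))).
Proof.
apply/span_subvP/memv_imgP => [sU|[w _ ->] _ /mapP[k _ ->]]; last first.
  by rewrite coeff_row_ext; apply/mul_basis_mxP; exists (coeff_row w k).
have coefU k : coeff_row v k \in U by rewrite sU // map_f // mem_enum.
pose y k := coeff_row v k *m pinvmx (basis_mx U).
exists (\sum_(k < \dim {:L}) ((vbasis {:L})`_k : K) *: map_mx (in_alg K) (y k)).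
  exact: memvf.
rewrite linear_sum {1}(coeff_rowE v); apply: eq_bigr => k _.
rewrite linearZ /= mul_homE -map_mxM; congr (_ *: map_mx _ _).
rewrite /y; have /mul_basis_mxP[w ->] := coefU k.
by rewrite mulmxKp ?row_free_basis_mx.
Qed.

Lemma suppP n (U : {vspace 'rV[F]_n}) X :
  (supp X <= U)%VS = (X <= limg (ext_hom (basis_mx U)))%VS.
Proof.
by apply/subv_sumP/subvP => sXU v /sXU; rewrite vsuppP.
Qed.

(** Row rank is at most column rank: coordinates in a basis of the [F]-span [E] of the entries give
    [\dim E] rows [e r], and every coefficient row is a combination of them. *)
Lemma dim_vsupp n (v : 'rV[K]_n) : (\dim (vsupp v) <= rank_weight v)%N.
Proof.
rewrite /rank_weight; set E := span _.
have vE l : (v 0 l : L) \in E by rewrite memv_span // map_f // mem_enum.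
pose e r : 'rV[F]_n := \row_l coord (vbasis E) r (v 0 l : L).
apply: leq_trans (_ : size [seq e r | r : 'I_(\dim E)] <= _)%N; last first.
  by rewrite size_map -cardE card_ord.
apply: leq_trans (dim_span _); apply/dimvS/span_subvP => _ /mapP[k _ ->].
have -> : coeff_row v k = \sum_(r < \dim E) cf k (vbasis E)`_r *: e r.
  apply/rowP=> l; rewrite mxE {1}(coord_vbasis (vE l)) linear_sum summxE.
  by apply: eq_bigr => r _; rewrite linearZ !mxE mulrC.
by apply: rpred_sum => r _; rewrite rpredZ // memv_span // map_f // mem_enum.
Qed.

Lemma dim_supp i n (X : {vspace 'rV[K]_n}) :
  X \in rml_spaces L i n -> (\dim (supp X) <= i * \dim X)%N.
Proof.
case/rml_spacesP=> s /andP[_ /allP sT] ->.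
have [s' [s's fs' <-]] := free_subseq s.
apply: leq_trans (_ : \dim (\sum_(v <- s') vsupp v)%VS <= _)%N; last first.
  rewrite (eqP fs') (leq_trans (dimv_leq_sum _ _ _)) // mulnC.
  rewrite -sum1_size big_distrl /= big_seq [X in (_ <= X)%N]big_seq.
  apply: leq_sum => v /s's/sT /[!inE] wv.
  by rewrite mul1n (leq_trans (dim_vsupp v)).
(* By [suppP], containing the supports of the generators is enough to contain the support of their
   span. *)
apply: dimvS; rewrite suppP; apply/span_subvP => v vs'; rewrite -vsuppP.
by rewrite (big_rem v) //= addvSl.
Qed.

End Support.

(** * Möbius inversion over supports *)

Lemma sum_subspaces_dim (F : finFieldType) n (U : {vspace 'rV[F]_n}) a b
    (g : nat -> int) :
  \sum_(V : {vspace 'rV[F]_n} | (V <= U)%VS && (a <= \dim V < b)%N) g (\dim V)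
    = \sum_(a <= t < b) (qbinom F (\dim U) t)%:Z * g t.
Proof.
transitivity (\sum_(V : {vspace 'rV[F]_n} | (V <= U)%VS)
    \sum_(a <= t < b | t == \dim V) g t).
  by rewrite big_mkcondr; apply: eq_bigr => V _; rewrite big_nat1_eq.
rewrite (exchange_big_dep predT) //=; apply: eq_bigr => t _.
rewrite sumr_const -card_subspaces cardsE -mulr_natl natz; congr (_%:Z * _).
by apply: eq_card => V; rewrite -!topredE /= eq_sym.
Qed.

Section Whitney.
Variables (F : finFieldType) (L : fieldExtType F) (i j : nat).
Local Notation K := (finvect_type L).
Local Notation q := #|F|.

Lemma whitney1_small n : (n < j)%N -> whitney1 L i n j = 0.
Proof.
move=> nj; rewrite /whitney1 big_pred0 // => X; apply/negbTE.
rewrite neq_ltn; apply/orP; left; apply: leq_ltn_trans nj.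
by rewrite (leq_trans (dimvS (subvf _))) // dimvf /= /dim /= mul1n.
Qed.

Section Interval.
Variables (n : nat) (U : {vspace 'rV[F]_n}).
Local Notation B := (basis_mx U).

Definition rml_ext (Y : rmlattice L i (\dim U)) : rmlattice L i n :=
  Sub (ext_hom L B @: val Y)%VS (rml_spaces_ext B (valP Y)).

(** The right inverse [pinvmx B] of [B] also has entries in [F], so it does not raise ranks and
    sends lattice elements to lattice elements. *)
Definition rml_res (X : rmlattice L i n) : rmlattice L i (\dim U) :=
  Sub (ext_hom L (pinvmx B) @: val X)%VS (rml_spaces_ext (pinvmx B) (valP X)).

Lemma rml_extK : cancel rml_ext rml_res.
Proof.
move=> Y; apply: val_inj; rewrite /= -limg_comp -[RHS]lim1g.
apply: eq_in_limg => v _; rewrite comp_lfunE id_lfunE !ext_homM.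
by rewrite mulmxVp ?row_free_basis_mx // mul_homE map_mx1 mulmx1.
Qed.

Lemma rml_resK (X : rmlattice L i n) :
  (val X <= limg (ext_hom L B))%VS -> rml_ext (rml_res X) = X.
Proof.
move=> /subvP sX; apply: val_inj; rewrite /= -limg_comp -[RHS]lim1g.
apply: eq_in_limg => v /sX/memv_imgP[w _ ->].
rewrite comp_lfunE id_lfunE !ext_homM.
by rewrite mulmxA mulmxVp ?row_free_basis_mx // mul1mx.
Qed.

Lemma lker_ext : lker (ext_hom L B) == 0%VS.
Proof. by rewrite lker_mul_hom // row_free_map row_free_basis_mx. Qed.

Lemma sum_mobius_supp_sub :
  \sum_(X : rmlattice L i n | (\dim (val X) == j) && (supp (val X) <= U)%VS)
     mobius (rml0 L i n) X = whitney1 L i (\dim U) j.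
Proof.
have ext_mono : {mono rml_ext : x y / (x <= y)%O}.
  by move=> X Y; rewrite !leEsub; apply: limg_ker0 lker_ext.
have ext0 : rml_ext (rml0 L i (\dim U)) = rml0 L i n.
  by apply: val_inj; rewrite /= limg0.
rewrite (reindex_onto rml_ext rml_res) /=; last first.
  by move=> X /andP[_]; rewrite suppP; apply: rml_resK.
apply: eq_big => [Y|Y _]; last first.
  (* Whatever lies below an image lies in the extension of [U], hence is an image by [rml_resK]. *)
  rewrite -ext0; apply: mobius_embed => // X Z ZX.
  exists (rml_res Z); rewrite rml_resK //.
  by apply: subv_trans ZX _; rewrite limgS ?subvf.
rewrite rml_extK eqxx suppP limgS ?subvf // !andbT limg_dim_eq //.
by rewrite (eqP lker_ext) capv0.
Qed.
End Interval.

(** Expand the right side by [sum_mobius_supp_sub] and exchange sums: the Möbius value of X gets as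
    coefficient the sum of [gauss_mobius] over all V between its support and [U], which is 1 if the
    support equals [U] and 0 otherwise. *)
Lemma sum_mobius_supp n (U : {vspace 'rV[F]_n}) : (0 < j)%N ->
  \sum_(X : rmlattice L i n | (\dim (val X) == j) && (supp (val X) == U))
     mobius (rml0 L i n) X
  = \sum_(1 <= t < (\dim U).+1) (qbinom F (\dim U) t)%:Z *
      (gauss_mobius q (\dim U - t) * whitney1 L i t j).
Proof.
move=> j_gt0.
transitivity (\sum_(V : {vspace 'rV[F]_n} | (V <= U)%VS)
    gauss_mobius q (\dim U - \dim V) * whitney1 L i (\dim V) j); last first.
  rewrite -sum_subspaces_dim [RHS]big_mkcondr; apply: eq_bigr => V VU.
  (* The range starts at [t = 1], so the zero subspace must contribute nothing; it does because
     [0 < j]. *)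
  rewrite ltnS dimvS // andbT; case: posnP => // ->.
  by rewrite whitney1_small ?mulr0.
under [RHS]eq_bigr => V _ do rewrite -sum_mobius_supp_sub mulr_sumr.
rewrite (exchange_big_dep (fun X => \dim (val X) == j)) /=; last first.
  by move=> V X _ /andP[].
rewrite big_mkcondr; apply: eq_bigr => X dX; rewrite -mulr_suml.
rewrite (eq_bigl (fun V => (supp (val X) <= V)%VS && (V <= U)%VS)); last first.
  by move=> V; rewrite dX /= andbC.
have [sXU|sXU] := boolP (supp (val X) <= U)%VS.
  by rewrite sum_gauss_mobius //; case: eqP; rewrite ?mul1r ?mul0r.
rewrite ifN; last by apply: contra sXU => /eqP->.
rewrite big_pred0 ?mul0r // => V; apply/negP => /andP[sXV /(subv_trans sXV)].
exact/negP.
Qed.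
End Whitney.

Theorem theorem6p2 (q i j n m : nat) (F : finFieldType) (L : fieldExtType F)
    (hq : #|F| = q) (hm : \dim {:L}%VS = m)
    (hi : (0 < i)%N) (hj : (0 < j)%N) (hn : (0 < n)%N) (hm0 : (0 < m)%N)
    (hij : (1 <= i * j <= minn n m)%N) :
  whitney1 L i n j =
    \sum_(1 <= s < (i * j).+1)
      (qbinom F n s)%:Z *
      \sum_(1 <= t < s.+1)
        whitney1 L i t j * (qbinom F s t)%:Z *
        (q ^ 'C(s - t, 2))%N%:Z * (-1) ^+ (s - t).
Proof.
(* By [sum_mobius_supp], [g s] is the total Möbius value of the X of dimension [j] with a prescribed
   support of dimension [s]. *)
pose g s := \sum_(1 <= t < s.+1) (qbinom F s t)%:Z *
  (gauss_mobius q (s - t) * whitney1 L i t j).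
transitivity (\sum_(1 <= s < (i * j).+1) (qbinom F n s)%:Z * g s); last first.
  apply: eq_bigr => s _; congr (_ * _); apply: eq_bigr => t _.
  rewrite /gauss_mobius [RHS]mulrC [LHS]mulrC -!mulrA; congr (_ * _).
  by rewrite mulrC -mulrA.
rewrite -[n in qbinom F n]mul1n -[(1 * n)%N](dimvf 'rV[F]_n).
rewrite -sum_subspaces_dim /whitney1.
rewrite (partition_big (fun X => supp (val X)) predT) //= [RHS]big_mkcond /=.
apply: eq_bigr => U _; rewrite subvf /= /g -hq -sum_mobius_supp //.
(* Supports outside the range contribute 0: in dimension 0 the inner sum is empty, and above [i * j]
   no X exists by [dim_supp]. *)
case: ifPn => //; rewrite ltnS negb_and -leqNgt leqn0 -ltnNge.
case/orP=> [/eqP dU|dU].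
  by rewrite sum_mobius_supp // dU big_geq.
rewrite big_pred0 // => X; apply/andP => -[/eqP dX /eqP sX].
by move: dU; rewrite -sX -dX ltnNge dim_supp ?(valP X).
Qed.
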